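(* Let $\alpha$ be a prenaming. Then its closure $\overline{\alpha}$ is a renaming which coincides with $\alpha$ on $V\setminus(R^+(\alpha)\setminus C^+(\alpha))$ and satisfies $\mathrm{vars}(\overline{\alpha})\subseteq V^+(\alpha)$. Additionally, if $\alpha(x)\neq x$ for all $x\in C^+(\alpha)$, then $\overline{\alpha}(x)\neq x$ for all $x\in V^+(\alpha)$.
   Context: $V$ is a countably infinite set of variables. A substitution is a map from variables to terms with finite active domain $\mathrm{Dom}(\theta)=\{x:\theta(x)\neq x\}$; $\mathrm{vars}(\theta)=\mathrm{Dom}(\theta)\cup\mathrm{vars}(\theta(\mathrm{Dom}(\theta)))$. A renaming is a bijective substitution mapping variables to variables. A prenaming is a substitution $\alpha$ mapping variables to variables together with a fixed finite set $C^+(\alpha)\supseteq\mathrm{Dom}(\alpha)$ (relaxed core) on which $\alpha$ is injective; $R^+(\alpha)=\alpha(C^+(\alpha))$ and $V^+(\alpha)=C^+(\alpha)\cup R^+(\alpha)$. The closure $\overline{\alpha}$ of $\alpha$ is defined by: $\overline{\alpha}(x)=\alpha(x)$ if $x\in C^+(\alpha)$; for $x\in R^+(\alpha)\setminus C^+(\alpha)$, $\overline{\alpha}(x)=z$ where $z$ is the start of the maximal chain $z,\alpha(z),\dots,\alpha^m(z)=x$ with $z,\alpha(z),\dots,\alpha^{m-1}(z)\in C^+(\alpha)$ (i.e. $\alpha^m(z)=x$ for maximal $m$; such $z$ lies in $C^+(\alpha)\setminus R^+(\alpha)$); and $\overline{\alpha}(x)=x$ outside $C^+(\alpha)\cup R^+(\alpha)$.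 *)

(* Defs.v *)
From HB Require Import structures.
From mathcomp Require Export all_boot.
From mathcomp Require Export all_classical.

Set Implicit Arguments.
Unset Strict Implicit.
Unset Printing Implicit Defensive.

Local Open Scope classical_set_scope.

Section Terms.
Variables (F : Type) (ar : F -> nat) (V : countType).

Inductive term : Type :=
| Var of V
| App (f : F) of {ffun 'I_(ar f) -> term}.

Fixpoint term_vars (t : term) : set V :=
  match t with
  | Var x => [set x]
  | App f a => \bigcup_i term_vars (a i)
  end.

Fixpoint subst_app (theta : V -> term) (t : term) : term :=
  match t with
  | Var x => theta x
  | App f a => App [ffun i => subst_app theta (a i)]
  end.

Definition subst_dom (theta : V -> term) : set V :=
  [set x | theta x <> Var x].

Definition is_subst (theta : V -> term) : Prop :=
  finite_set (subst_dom theta).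

Definition subst_vars (theta : V -> term) : set V :=
  subst_dom theta `|` \bigcup_(x in subst_dom theta) term_vars (theta x).

Definition maps_vars_to_vars (theta : V -> term) : Prop :=
  forall x, exists y, theta x = Var y.

(* Bijectivity is that of a map from V to V, the latter seen inside the terms
   through Var. *)
Definition is_renaming (rho : V -> term) : Prop :=
  [/\ is_subst rho, maps_vars_to_vars rho &
      set_bij [set: V] (range Var) rho].

Record prenaming := Prenaming {
  pre_fun :> V -> term;
  pre_core : set V;
  pre_subst : is_subst pre_fun;
  pre_vars_to_vars : maps_vars_to_vars pre_fun;
  pre_core_finite : finite_set pre_core;
  pre_dom_core : subst_dom pre_fun `<=` pre_core;
  pre_core_inj : set_inj pre_core pre_fun
}.

Definition pre_range (alpha : prenaming) : set V :=
  Var @^-1` (alpha @` pre_core alpha).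

Definition pre_allvars (alpha : prenaming) : set V :=
  pre_core alpha `|` pre_range alpha.

Definition pre_iter (alpha : prenaming) (i : nat) (z : V) : term :=
  iter i (subst_app alpha) (Var z).

Definition is_chain (alpha : prenaming) (x z : V) (m : nat) : Prop :=
  pre_iter alpha m z = Var x /\
  forall i, (i < m)%N -> (Var @` pre_core alpha) (pre_iter alpha i z).

Definition is_chain_start (alpha : prenaming) (x z : V) : Prop :=
  exists m, is_chain alpha x z m /\
    forall z' m', is_chain alpha x z' m' -> (m' <= m)%N.

(* On [pre_range alpha `\` pre_core alpha], the only place where it is used,
   the start of the maximal chain exists and is unique; elsewhere [xget] may
   return its default value x. *)
Definition chain_start (alpha : prenaming) (x : V) : V :=
  xget x [set z | is_chain_start alpha x z].

Definition pre_closure (alpha : prenaming) (x : V) : term :=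
  if x \in pre_core alpha then alpha x
  else if x \in pre_range alpha then Var (chain_start alpha x)
  else Var x.

End Terms.

Arguments Var {F ar V}.
Arguments App {F ar V}.

(* Main.v *)
Require Import Defs.

(** The prenaming is a map [f] on variables, injective on the finite core [C].
    A chain in [C] that repeats an element never leaves [C]; so the chains
    ending at some [x] outside [C] have bounded length, and for [x] in the
    range a longest one starts in [C] minus the range.  The closure therefore sends the three regions [C],
    range minus [C], and the rest injectively into the pairwise disjoint
    regions range, [C] minus range, and the rest; being an injective self-map
    of a finite set extended by the identity, it is bijective. *)

Set Implicit Arguments.
Unset Strict Implicit.
Unset Printing Implicit Defensive.

Local Open Scope classical_set_scope.

(** [N] is the size of a list enumerating [S]: a duplicate-free list of values in [S] cannot be
    longer. *)
Lemma finite_set_pigeonhole (T : eqType) (S : set T) : finite_set S ->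
  exists N, forall (u : nat -> T) m, (forall i, i < m -> S (u i)) -> N < m ->
    exists i j, [/\ i < j, j < m & u i = u j].
Proof.
move=> /finite_seqP[s ->]; exists (size s) => u m us ltm.
case: (boolP (uniq [seq u i | i <- iota 0 m])) => [us_uniq|].
  have : size [seq u i | i <- iota 0 m] <= size s.
    apply: uniq_leq_size => // _ /mapP[i + ->].
    by rewrite mem_iota add0n => /andP[_ /us].
  by rewrite size_map size_iota leqNgt ltm.
have x0 := u 0.
move=> /(uniqPn x0)[i [j [ij]]]; rewrite size_map size_iota => jm.
have im := ltn_trans ij jm.
rewrite !(nth_map 0) ?size_iota // !nth_iota // !add0n => uij.
by exists i, j.
Qed.

(** The orbit of [y] stays in [S], so it repeats. Cancelling the common iterates by injectivity
    makes [y] periodic, and the point just before its return is the preimage. *)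
Lemma finite_set_inj_surj (T : eqType) (S : set T) (g : T -> T) :
  finite_set S -> {homo g : x / S x} -> injective g ->
  forall y, S y -> exists2 x, S x & g x = y.
Proof.
move=> finS gS ginj y Sy.
have Siter i : S (iter i g y) by elim: i => //= i; exact: gS.
have itinj i : injective (iter i g) by elim: i => // i IH a b /= /ginj/IH.
have [N HN] := finite_set_pigeonhole finS.
have [//|//|i [j [ij _]]] := HN (fun i => iter i g y) N.+1.
rewrite -(subnKC (ltnW ij)) iterD => /itinj.
case: (j - i) (subn_gt0 i j) => [|k _]; first by rewrite ij.
by rewrite iterS => yE; exists (iter k g y).
Qed.

Section Chain.
Variables (T : eqType) (f : T -> T) (C : set T).
Hypotheses (finC : finite_set C) (finj : set_inj C f).

Definition chain (x z : T) (m : nat) : Prop :=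
  iter m f z = x /\ forall i, i < m -> C (iter i f z).

Definition longest_chain (x z : T) (m : nat) : Prop :=
  chain x z m /\ forall z' m', chain x z' m' -> m' <= m.

Lemma chain_length_bounded x : ~ C x ->
  exists N, forall z m, chain x z m -> m <= N.
Proof.
move=> nCx; have [N HN] := finite_set_pigeonhole finC.
exists N => z m [zx zC]; rewrite leqNgt; apply/negP => Nm.
have [i [j [ij jm eqij]]] := HN _ _ zC Nm.
(* Cutting out the loop between [i] and [j] reaches [x] already at index [m - j + i < m], where the
   chain is still in [C]. *)
apply: nCx; rewrite -zx -(subnK (ltnW jm)) iterD -eqij -iterD.
by apply: zC; rewrite -[ltnRHS](subnK (ltnW jm)) ltn_add2l.
Qed.

Lemma longest_chain_exists x : ~ C x -> exists z m, longest_chain x z m.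
Proof.
move=> nCx; have [N HN] := chain_length_bounded nCx.
have ex0 : exists m, `[< exists z, chain x z m >].
  (* The chain of length 0 from [x] to itself. *)
  by exists 0; apply/asboolP; exists x.
have leN m : `[< exists z, chain x z m >] -> m <= N.
  by move=> /asboolP[z /HN].
have [m /asboolP[z zm] maxm] := ex_maxnP ex0 leN.
by exists z, m; split=> // z' m' c'; apply: maxm; apply/asboolP; exists z'.
Qed.

(** A preimage of [x] in [C] is a chain of length 1, so [0 < m] and [z] is constrained to [C]. A
    preimage of [z] in [C] would prolong the chain. *)
Lemma longest_chain_start x z m : (f @` C) x -> longest_chain x z m ->
  C z /\ ~ (f @` C) z.
Proof.
move=> [w Cw wx] [[zx zC] maxm]; split.
  by apply: (zC 0); apply: (maxm w); split=> // -[].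
move=> [v Cv vz]; suff /maxm : chain x v m.+1 by rewrite ltnn.
split=> [|[//|i im]]; first by rewrite iterSr vz.
by rewrite iterSr vz; apply: zC.
Qed.

(** Were the lengths different, the end of the shorter chain would be an inner element of the longer
    one, hence in [C]. *)
Lemma chain_end_unique z x x' m m' : ~ C x -> ~ C x' ->
  chain x z m -> chain x' z m' -> x = x'.
Proof.
move=> nCx nCx' [zx zC] [zx' zC']; case: (ltngtP m m') => [/zC'|/zC|mm'].
- by rewrite zx.
- by rewrite zx'.
- by rewrite -zx -zx' mm'.
Qed.

Section Closure.
Variable start : T -> T.
Hypothesis startP : forall x, ~ C x -> exists m, longest_chain x (start x) m.

(** Counterpart of [pre_closure] without terms, for an arbitrary choice [start] of longest
    chains. *)
Definition chain_closure (x : T) : T :=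
  if x \in C then f x else if x \in f @` C then start x else x.

Variant chain_closure_spec x : T -> Prop :=
| ChainClosureCore of C x : chain_closure_spec x (f x)
| ChainClosureRange of ~ C x & (f @` C) x : chain_closure_spec x (start x)
| ChainClosureOut of ~ C x & ~ (f @` C) x : chain_closure_spec x x.

Lemma chain_closureP x : chain_closure_spec x (chain_closure x).
Proof.
rewrite /chain_closure; case: ifPn => [/set_mem|/negP xC].
  exact: ChainClosureCore.
have nCx : ~ C x by move=> /mem_set.
case: ifPn => [/set_mem|/negP xR]; first exact: ChainClosureRange.
by apply: ChainClosureOut => // /mem_set.
Qed.

Lemma start_core x : ~ C x -> (f @` C) x -> C (start x).
Proof.
by move=> /startP[m lc] Rx; case: (longest_chain_start Rx lc).
Qed.

Lemma start_range x : ~ C x -> (f @` C) x -> ~ (f @` C) (start x).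
Proof.
by move=> /startP[m lc] Rx; case: (longest_chain_start Rx lc).
Qed.

Lemma chain_closure_inj : injective chain_closure.
Proof.
have Rf v : C v -> (f @` C) (f v) by move=> Cv; exists v.
move=> x y.
case: (chain_closureP x) => [Cx|nCx Rx|nCx nRx];
  case: (chain_closureP y) => [Cy|nCy Ry|nCy nRy] //.
- by apply: finj; rewrite ?inE.
- by move=> e; have := start_range nCy Ry; rewrite -e => /(_ (Rf _ Cx)).
- by move=> e; have := Rf _ Cx; rewrite e.
- by move=> e; have := start_range nCx Rx; rewrite e => /(_ (Rf _ Cy)).
(* Both points end a chain from the same start, outside [C]. *)
- move=> e; have [m [cx _]] := startP nCx; have [n [cy _]] := startP nCy.
  by rewrite e in cx; apply: chain_end_unique cx cy.
- by move=> e; have := start_core nCx Rx; rewrite e.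
- by move=> e; have := Rf _ Cy; rewrite -e.
- by move=> e; have := start_core nCy Ry; rewrite -e.
Qed.

Lemma chain_closure_stable : {homo chain_closure : x / (C `|` f @` C) x}.
Proof.
move=> x; case: (chain_closureP x) => // [Cx _|nCx Rx _].
- by right; exists x.
- by left; apply: start_core.
Qed.

Lemma chain_closure_out x : ~ (C `|` f @` C) x -> chain_closure x = x.
Proof.
move=> nS; case: (chain_closureP x) => // [Cx|_ Rx]; case: nS.
- by left.
- by right.
Qed.

Lemma chain_closure_surj y : exists x, chain_closure x = y.
Proof.
have [Sy|/chain_closure_out nSy] := pselect ((C `|` f @` C) y); last by exists y.
have finS : finite_set (C `|` f @` C).
  by rewrite finite_setU; split=> //; exact: finite_image.
have [x _ xy] :=
  finite_set_inj_surj finS chain_closure_stable chain_closure_inj Sy.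
by exists x.
Qed.

(** On the range outside [C] no assumption on [f] is needed: the value lies in [C], the argument
    does not. *)
Lemma chain_closure_fix_free : (forall x, C x -> f x <> x) ->
  forall x, (C `|` f @` C) x -> chain_closure x <> x.
Proof.
move=> ff x; case: (chain_closureP x) => [Cx _|nCx Rx _ e|nCx nRx []] //.
  exact: ff.
by have := start_core nCx Rx; rewrite e.
Qed.

End Closure.
End Chain.

Section Prenaming.
Variables (F : Type) (ar : F -> nat) (V : countType) (alpha : prenaming ar V).
Variable f : V -> V.
Hypothesis alphaE : forall x, alpha x = Var (f x).
Let C := pre_core alpha.

Lemma Var_inj : injective (@Var F ar V).
Proof. by move=> x y []. Qed.

Lemma pre_core_fun_inj : set_inj C f.
Proof.
by move=> x y Cx Cy fxy; apply: (pre_core_inj Cx Cy); rewrite !alphaE fxy.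
Qed.

Lemma pre_rangeE : pre_range alpha = f @` C.
Proof.
apply/seteqP; split=> y [x Cx xy]; exists x => //.
  by move: xy; rewrite alphaE => /Var_inj.
by rewrite alphaE xy.
Qed.

Lemma pre_iterE i z : pre_iter alpha i z = Var (iter i f z).
Proof. by rewrite /pre_iter; elim: i => //= i ->; rewrite /= alphaE. Qed.

Lemma is_chainE x z m : is_chain alpha x z m <-> chain f C x z m.
Proof.
rewrite /is_chain /chain pre_iterE; split=> -[zx zC].
  split=> [|i /zC]; first exact: Var_inj.
  by rewrite pre_iterE => -[v Cv /Var_inj <-].
split=> [|i /zC]; first by rewrite zx.
by rewrite pre_iterE => Ci; exists (iter i f z).
Qed.

Lemma chain_startP x : ~ C x ->
  exists m, longest_chain f C x (chain_start alpha x) m.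
Proof.
move=> nCx; have [z [m [zm maxm]]] :=
  longest_chain_exists f (@pre_core_finite _ _ _ alpha) nCx.
have : is_chain_start alpha x (chain_start alpha x).
  (* A longest chain exists for every [x] outside the core, so [xget] returns a genuine start. *)
  apply: (@xgetPex _ x [set z | is_chain_start alpha x z]); exists z, m.
  by split=> [|z' m' /is_chainE/maxm//]; apply/is_chainE.
move=> [k [/is_chainE ck maxk]]; exists k; split=> // z' m' /is_chainE.
exact: maxk.
Qed.

Lemma pre_closureE x :
  pre_closure alpha x = Var (chain_closure f C (chain_start alpha) x).
Proof.
rewrite /pre_closure /chain_closure pre_rangeE alphaE.
by case: ifP => // _; case: ifP.
Qed.

End Prenaming.

Theorem mainTheorem3 (F : Type) (ar : F -> nat) (V : countType)
    (V_infinite : infinite_set [set: V]) (alpha : prenaming ar V) :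
  [/\ is_renaming (pre_closure alpha),
      (forall x, (~` (pre_range alpha `\` pre_core alpha)) x ->
         pre_closure alpha x = alpha x),
      subst_vars (pre_closure alpha) `<=` pre_allvars alpha &
      (forall x, pre_core alpha x -> alpha x <> Var x) ->
      forall x, pre_allvars alpha x -> pre_closure alpha x <> Var x].
Proof.
have [f alphaE] := choice (@pre_vars_to_vars _ _ _ alpha).
have finC := @pre_core_finite _ _ _ alpha.
have stP := chain_startP alphaE.
have finj := pre_core_fun_inj alphaE.
have clE := pre_closureE alphaE.
have allE : pre_allvars alpha = pre_core alpha `|` f @` pre_core alpha.
  by rewrite /pre_allvars (pre_rangeE alphaE).
have domS : subst_dom (pre_closure alpha) `<=` pre_allvars alpha.
  move=> x dx; apply: contrapT; rewrite allE => nx; apply: dx.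
  by rewrite clE chain_closure_out.
split.
- split.
  + apply: sub_finite_set domS _; rewrite allE finite_setU; split=> //.
    exact: finite_image.
  + by move=> x; eexists; exact: clE.
  + split.
    * by move=> x _; rewrite clE; eexists.
    * move=> x y _ _; rewrite !clE => /Var_inj.
      exact: (chain_closure_inj finj stP).
    * move=> _ [y _ <-]; have [x <-] := chain_closure_surj finC finj stP y.
      by exists x; rewrite ?clE.
- move=> x; rewrite clE alphaE (pre_rangeE alphaE) => nRC.
  case: (chain_closureP f (pre_core alpha) (chain_start alpha) x) => // nCx nRx.
    by case: nRC.
  (* Here the closure fixes [x]; so does [alpha], as otherwise [x] would lie in its domain, hence in
     the core. *)
  apply: contrapT => xE; apply/nCx/pre_dom_core.
  by rewrite /subst_dom /= alphaE => /esym.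
(* The image of [x] is a single variable, so [y] is the closure's value at [x], and stability
   applies. *)
- move=> y [/domS //|[x /domS]]; rewrite clE allE => Sx ->.
  exact: (chain_closure_stable stP).
- move=> ff x; rewrite allE clE => Sx /Var_inj.
  apply: (chain_closure_fix_free stP) Sx => {}x /ff; rewrite alphaE.
  by move=> + e; rewrite e.
Qed.
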